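(* Let $E$ be a finite set. Truncation on $\mathrm{Mat}(E)$ is a matroid correspondence; that is, there exists a matroid $\mathscr{C}$ on $E\sqcup E^*$ such that $\mathscr{C}_*(M)=T(M)^*$ for every matroid $M$ on $E$.
   Context: All matroids are on finite ground sets. $\mathrm{Mat}(E)$ denotes the poset category of matroids on $E$ with matroid quotients as morphisms. The truncation $T(M)$ of a matroid $M$ on $E$ is the matroid on $E$ whose bases are the independent sets of $M$ of size $\mathrm{rk}(M)-1$; if $\mathrm{rk}(M)=0$ then $T(M)=M$. $E^*$ is a set disjoint from $E$ with a natural bijection $e\mapsto e^*$, and for a matroid $M$ on $E$, $M^*$ denotes the copy of $M$ on $E^*$ via this bijection (not the dual matroid). For matroids $M,N$ on the same ground set, the intersection $M\wedge N$ is the matroid whose bases are the inclusion-minimal sets among $\{B\cap B' : B \text{ a basis of } M,\ B'\text{ a basis of } N\}$. $\mathbf{B}_{E}$ is the Boolean matroid on $E$ (only basis $E$). For disjoint finite sets $E_1,E_2$ and a matroid $\mathscr{C}$ on $E_1\sqcup E_2$, the matroid correspondence $\mathscr{C}_*:\mathrm{Mat}(E_1)\to\mathrm{Mat}(E_2)$ is $\mathscr{C}_*(M):=\big((M\oplus \mathbf{B}_{E_2})\wedge \mathscr{C}\big)\setminus E_1$. *)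

(* Defs.v *)
From HB Require Import structures.
From mathcomp Require Import all_boot.
From mathcomp Require Import zify.

Set Implicit Arguments.
Unset Strict Implicit.
Unset Printing Implicit Defensive.

(* The ground set of a matroid is a finType (possibly empty), and a matroid is
   determined by its set of bases.  A disjoint union of ground sets is the sum
   type.  The axioms are boolean, so two matroids are equal as soon as they
   have the same bases. *)

Definition exchange (T : finType) (F : {set {set T}}) : bool :=
  [forall A in F, forall B in F, forall x in A :\: B,
    exists y in B :\: A, y |: (A :\ x) \in F].

Record matroid (T : finType) := Matroid {
  bases : {set {set T}};
  matroid_axiom : (bases != set0) && exchange bases }.

HB.instance Definition _ (T : finType) := [isSub for @bases T].

Definition indep (T : finType) (M : matroid T) (I : {set T}) : bool :=
  [exists B in bases M, I \subset B].

Definition rk (T : finType) (M : matroid T) : nat :=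
  \max_(B in bases M) #|B|.

(* Independent-set axioms, used to show that the operations below produce
   matroids. *)
Definition indep_axioms (T : finType) (P : pred {set T}) : Prop :=
  [/\ P set0,
      forall I J : {set T}, I \subset J -> P J -> P I
    & forall I J : {set T}, P I -> P J -> #|I| < #|J| ->
        exists2 x, x \in J :\: I & P (x |: I)].

Section BasisExchange.
Variable T : finType.
Implicit Types (M : matroid T) (A B I J : {set T}) (F : {set {set T}}).

Lemma exchangeP F :
  reflect (forall A B, A \in F -> B \in F -> forall x, x \in A :\: B ->
             exists2 y, y \in B :\: A & y |: (A :\ x) \in F)
          (exchange F).
Proof.
apply: (iffP forall_inP) => [h A B AF BF x xAB | h A AF].
  have /forall_inP/(_ B BF)/forall_inP/(_ x xAB)/exists_inP[y y1 y2] := h A AF.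
  by exists y.
apply/forall_inP => B BF; apply/forall_inP => x xAB; apply/exists_inP.
by have [y y1 y2] := h A B AF BF x xAB; exists y.
Qed.

Lemma bases_ex M : exists B, B \in bases M.
Proof. by have /andP[/set0Pn] := matroid_axiom M. Qed.

Lemma basesX M A B x : A \in bases M -> B \in bases M -> x \in A :\: B ->
  exists2 y, y \in B :\: A & y |: (A :\ x) \in bases M.
Proof.
have /andP[_ /exchangeP h] := matroid_axiom M.
by move=> hA hB; apply: h.
Qed.

Lemma card_exch A x y : x \in A -> y \notin A -> #|y |: (A :\ x)| = #|A|.
Proof.
move=> xA yA; rewrite cardsU1 !inE (negbTE yA) andbF /=.
by rewrite (cardsD1 x A) xA.
Qed.

Lemma card_bases M A B : A \in bases M -> B \in bases M -> #|A| = #|B|.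
Proof.
have [n] := ubnP #|A :\: B|; elim: n A => // n IHn A ltn hA hB.
have [AB0 | [x xAB]] := set_0Vmem (A :\: B).
  have sAB : A \subset B by rewrite -setD_eq0 AB0.
  have [BA0 | [y yBA]] := set_0Vmem (B :\: A).
    have sBA : B \subset A by rewrite -setD_eq0 BA0.
    by apply: eq_card => z; apply/idP/idP; apply: subsetP.
  by have [z] := basesX hB hA yBA; rewrite AB0 inE.
have [y yBA hA'] := basesX hA hB xAB.
have /setDP[xA xB] := xAB; have /setDP[yB yA] := yBA.
rewrite -(card_exch xA yA); apply: IHn => //.
have sub : (y |: (A :\ x)) :\: B \subset (A :\: B) :\ x.
  apply/subsetP => z; rewrite !inE.
  case: (eqVneq z y) => [-> | _] /=; first by rewrite yB.
  by case: (z \in B); case: (z == x); case: (z \in A).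
have := subset_leq_card sub; move: ltn.
rewrite (cardsD1 x (A :\: B)) xAB; lia.
Qed.

Lemma card_basis M A : A \in bases M -> #|A| = rk M.
Proof.
move=> hA; apply/eqP; rewrite eqn_leq /rk leq_bigmax_cond //=.
by apply/bigmax_leqP => B hB; rewrite (card_bases hA hB).
Qed.

Lemma indepP M I : reflect (exists2 B, B \in bases M & I \subset B) (indep M I).
Proof. exact: exists_inP. Qed.

Lemma indep_extend M I B : indep M I -> B \in bases M ->
  exists2 B', B' \in bases M & I \subset B' /\ B' \subset I :|: B.
Proof.
case/indepP => A + + hB.
have [n] := ubnP #|A :\: (I :|: B)|; elim: n A => // n IHn A ltn hA sIA.
have [D0 | [x xD]] := set_0Vmem (A :\: (I :|: B)).
  by exists A => //; split=> //; rewrite -setD_eq0 D0.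
have := xD; rewrite !inE negb_or -andbA => /and3P[xI xB xA].
have xAB : x \in A :\: B by rewrite inE xA xB.
have [y yBA hA'] := basesX hA hB xAB.
have /setDP[yB yA] := yBA.
apply: IHn hA' _; last first.
  apply/subsetP => z zI; rewrite !inE (subsetP sIA) // andbT.
  by rewrite (contraNneq _ xI) ?orbT // => <-.
have sub : (y |: (A :\ x)) :\: (I :|: B) \subset (A :\: (I :|: B)) :\ x.
  apply/subsetP => z; rewrite !inE.
  case: (eqVneq z y) => [-> | _] /=; first by rewrite yB orbT.
  by case: (z \in I); case: (z \in B); case: (z == x); case: (z \in A).
have := subset_leq_card sub; move: ltn.
rewrite (cardsD1 x (A :\: (I :|: B))) xD; lia.
Qed.

Lemma indep_axiomsP M : indep_axioms (indep M).
Proof.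
split=> [|I J sIJ /indepP[B hB sJB]|I J hI /indepP[B hB sJB] ltIJ].
- by have [B hB] := bases_ex M; apply/indepP; exists B; rewrite ?sub0set.
- by apply/indepP; exists B => //; apply: subset_trans sJB.
have [A hA [sIA sAIB]] := indep_extend hI hB.
have [D0 | [x]] := set_0Vmem (A :&: (J :\: I)); last first.
  rewrite inE => /andP[xA xJI]; exists x => //.
  by apply/indepP; exists A => //; rewrite subUset sub1set xA.
have sub : A \subset I :|: (B :\: J).
  apply/subsetP => z zA; have := subsetP sAIB z zA.
  rewrite !inE; case: (boolP (z \in I)) => //= zI ->; rewrite andbT.
  by apply/negP => zJ; have := in_set0 z; rewrite -D0 !inE zA zI zJ.
have := subset_leq_card sub; have := (leq_card_setU I (B :\: J)).1.
have := cardsD B J; rewrite (setIidPr sJB) => ->.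
have := subset_leq_card sJB; have := card_bases hA hB.
move: ltIJ; lia.
Qed.

Lemma indep_axioms_matroid (P : pred {set T}) : indep_axioms P ->
  ([set J | maxset P J] != set0) && exchange [set J | maxset P J].
Proof.
case=> P0 Psub Paug; apply/andP; split.
  by have [J hJ _] := maxset_exists P0; apply/set0Pn; exists J; rewrite inE.
have cmax A B : maxset P A -> P B -> #|B| <= #|A|.
  move=> /maxsetP[PA maxA] PB; rewrite leqNgt; apply/negP => /(Paug _ _ PA PB)[x].
  rewrite inE => /andP[xA _] /maxA; rewrite subsetUr => /(_ isT) eA.
  by move: xA; rewrite -eA setU11.
apply/exchangeP => A B; rewrite !inE => hA hB x; rewrite inE => /andP[xB xA].
have PA := maxsetp hA; have PB := maxsetp hB.
have lt : #|A :\ x| < #|B|.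
  by have := cmax _ _ hB PA; rewrite (cardsD1 x A) xA.
have [y /setDP[yB yAx] Py] := Paug _ _ (Psub _ _ (subD1set A x) PA) PB lt.
have yA : y \notin A.
  by apply: contra yAx => yA; rewrite !inE yA (contraNneq _ xB) // => <-.
exists y; first by rewrite inE yA yB.
rewrite inE; apply/maxsetP; split=> // C PC sC; apply/eqP; rewrite eq_sym.
by rewrite eqEcard sC (card_exch xA yA) cmax.
Qed.

Lemma dual_axiom M :
  ([set ~: B | B in bases M] != set0) && exchange [set ~: B | B in bases M].
Proof.
apply/andP; split.
  by have [B hB] := bases_ex M; apply/set0Pn; exists (~: B); apply: imset_f.
apply/exchangeP => _ _ /imsetP[A hA ->] /imsetP[B hB ->] x.
rewrite !inE negbK => /andP[xB xA].
have hI : indep M (x |: (A :&: B)).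
  by apply/indepP; exists B => //; rewrite subUset sub1set xB subsetIr.
have [C hC [sC1 sC2]] := indep_extend hI hA.
have sC : C \subset x |: A.
  apply: subset_trans sC2 _; rewrite -setUA setUS // subUset subsetIl.
  exact: subxx.
have xC : x \in C by apply: (subsetP sC1); rewrite setU11.
have cC : #|C| = #|A| := card_bases hC hA.
have /subsetPn[y yA yC] : ~~ (A \subset C).
  apply/negP => sAC; have : x |: A \subset C by rewrite subUset sub1set xC.
  by move/subset_leq_card; rewrite cardsU1 xA cC; lia.
have yB : y \notin B.
  by apply: contra yC => yB; apply: (subsetP sC1); rewrite !inE yA yB orbT.
exists y; first by rewrite !inE yA yB.
apply/imsetP; exists C => //.
have -> : C = x |: (A :\ y).
  apply/eqP; rewrite eqEcard cC card_exch // leqnn andbT.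
  apply/subsetP => z zC; have := subsetP sC z zC; rewrite !inE.
  case: (z == x) => //= ->; rewrite andbT.
  by apply: contraNneq yC => <-.
apply/setP => z; rewrite !inE negb_or negb_and negbK.
case: (eqVneq z y) => [-> | _] //=.
by rewrite (contraNneq _ xA) // => <-.
Qed.

Definition dual M : matroid T := Matroid (dual_axiom M).

Definition indep_union (P Q : pred {set T}) : pred {set T} :=
  fun I => [exists A : {set T}, exists B : {set T},
    [&& P A, Q B & I == A :|: B]].

Lemma indep_unionP (P Q : pred {set T}) I :
  (forall A B, A \subset B -> Q B -> Q A) ->
  reflect (exists A B, [/\ P A, Q B, [disjoint A & B] & I = A :|: B])
          (indep_union P Q I).
Proof.
move=> Qsub; apply: (iffP existsP) => [[A] | [A [B [PA QB dAB ->]]]]; last first.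
  by exists A; apply/existsP; exists B; rewrite PA QB eqxx.
case/existsP => B /and3P[PA QB /eqP->].
exists A, (B :\: A); split=> //.
- by apply: Qsub QB; apply: subsetDl.
- by rewrite disjoint_sym disjoints_subset; apply/subsetP => z; rewrite !inE => /andP[].
by apply/setP => z; rewrite !inE; case: (z \in A).
Qed.

Lemma indep_union_aug (P Q : pred {set T}) (I1 I2 J1 J2 : {set T}) :
  indep_axioms P -> indep_axioms Q ->
  P I1 -> Q I2 -> [disjoint I1 & I2] -> P J1 -> Q J2 -> [disjoint J1 & J2] ->
  #|I1 :|: I2| < #|J1 :|: J2| ->
  exists2 x, x \in (J1 :|: J2) :\: (I1 :|: I2)
           & indep_union P Q (x |: (I1 :|: I2)).
Proof.
move=> hP hQ; have [n] := ubnP (#|J1 :\: I1| + #|J2 :\: I2|).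
elim: n P Q hP hQ I1 I2 J1 J2 => // n IHn.
have half (P Q : pred {set T}) (hP : indep_axioms P) (hQ : indep_axioms Q)
    (I1 I2 J1 J2 : {set T}) :
  #|J1 :\: I1| + #|J2 :\: I2| < n.+1 ->
  P I1 -> Q I2 -> [disjoint I1 & I2] -> P J1 -> Q J2 -> [disjoint J1 & J2] ->
  #|I1 :|: I2| < #|J1 :|: J2| -> #|I1| < #|J1| ->
  exists2 x, x \in (J1 :|: J2) :\: (I1 :|: I2)
           & indep_union P Q (x |: (I1 :|: I2)).
- move=> ltn PI QI dI PJ QJ dJ ltc lt1.
  have [_ _ Paug] := hP; have [x /setDP[xJ xI] Px] := Paug _ _ PI PJ lt1.
  have [xI2 | xI2] := boolP (x \in I2); last first.
    exists x; first by rewrite !inE xJ negb_or xI xI2.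
    apply/existsP; exists (x |: I1); apply/existsP; exists I2.
    by rewrite Px QI setUA eqxx.
  have xJ2 : x \notin J2 by have /disjointFr-> := dJ.
  have eU : (x |: I1) :|: (I2 :\ x) = I1 :|: I2.
    apply/setP => z; rewrite !inE; case: (eqVneq z x) => [-> | _] //=.
    by rewrite xI2 orbT.
  have e2 : J2 :\: (I2 :\ x) = J2 :\: I2.
    apply/setP => z; rewrite !inE; case: (eqVneq z x) => [-> | _] //=.
    by rewrite (negbTE xJ2) !andbF.
  have e1 : J1 :\: (x |: I1) = (J1 :\: I1) :\ x.
    by apply/setP => z; rewrite !inE negb_or andbA.
  have [_ Qsub _] := hQ.
  rewrite -eU; apply: IHn => //; rewrite ?eU //.
  + rewrite e1 e2; move: ltn; rewrite (cardsD1 x (J1 :\: I1)) inE xI xJ /=; lia.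
  + by apply: Qsub QI; apply: subD1set.
  rewrite disjoint_subset; apply/subsetP => z; rewrite !inE.
  case: (eqVneq z x) => [-> | _] //= zI.
  by have /disjointFr-> := dI.
move=> P Q hP hQ I1 I2 J1 J2 ltn PI QI dI PJ QJ dJ ltc.
have [lt1 | ge1] := ltnP #|I1| #|J1|.
  exact: (half P Q hP hQ).
have lt2 : #|I2| < #|J2|.
  have := ltc; rewrite !cardsU (disjoint_setI0 dI) (disjoint_setI0 dJ) cards0.
  lia.
have [||||x xD] := half Q P hQ hP I2 I1 J2 J1 _ QI PI _ QJ PJ _ _ lt2.
- by rewrite addnC.
- by rewrite disjoint_sym.
- by rewrite disjoint_sym.
- by rewrite setUC [J2 :|: J1]setUC.
rewrite [I2 :|: I1]setUC => /existsP[A /existsP[B /and3P[QA PB /eqP e]]].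
exists x; first by rewrite [J1 :|: J2]setUC [I1 :|: I2]setUC.
by apply/existsP; exists B; apply/existsP; exists A; rewrite PB QA e setUC eqxx.
Qed.

Lemma indep_union_axioms (P Q : pred {set T}) :
  indep_axioms P -> indep_axioms Q -> indep_axioms (indep_union P Q).
Proof.
move=> hP hQ; have [P0 Psub _] := hP; have [Q0 Qsub _] := hQ; split.
- apply/existsP; exists set0; apply/existsP; exists set0.
  by rewrite P0 Q0 setU0 eqxx.
- move=> I J sIJ /existsP[A /existsP[B /and3P[PA QB /eqP e]]].
  apply/existsP; exists (I :&: A); apply/existsP; exists (I :&: B).
  rewrite (Psub _ _ (subsetIr I A) PA) (Qsub _ _ (subsetIr I B) QB) /=.
  by rewrite -setIUr -e (setIidPl sIJ).
move=> I J /(indep_unionP _ _ Qsub)[I1 [I2 [PI QI dI ->]]].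
move=> /(indep_unionP _ _ Qsub)[J1 [J2 [PJ QJ dJ ->]]] ltIJ.
exact: (@indep_union_aug P Q).
Qed.

End BasisExchange.

(* For rk M = 0 the predecessor is 0 and this is M itself: truncation_rk0. *)
Definition truncation_bases (T : finType) (M : matroid T) : {set {set T}} :=
  [set I | indep M I & #|I| == (rk M).-1].

Lemma truncation_axiom (T : finType) (M : matroid T) :
  (truncation_bases M != set0) && exchange (truncation_bases M).
Proof.
have [P0 Psub Paug] := indep_axiomsP M.
have small k : k <= rk M -> exists2 I, indep M I & #|I| = k.
  elim: k => [|k IHk] lek; first by exists set0; rewrite ?cards0.
  have [I hI cI] := IHk (ltnW lek); have [B hB] := bases_ex M.
  have PB : indep M B by apply/indepP; exists B.
  have [|x /setDP[_ xI] Px] := Paug _ _ hI PB; first by rewrite cI (card_basis hB).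
  by exists (x |: I); rewrite // cardsU1 xI cI.
apply/andP; split.
  have [I hI cI] := small _ (leq_pred (rk M)).
  by apply/set0Pn; exists I; rewrite inE hI cI eqxx.
apply/exchangeP => A B; rewrite !inE => /andP[hA /eqP cA] /andP[hB /eqP cB] x.
rewrite inE => /andP[xB xA].
have lt : #|A :\ x| < #|B| by rewrite cB -cA (cardsD1 x A) xA.
have [y /setDP[yB yAx] Py] := Paug _ _ (Psub _ _ (subD1set A x) hA) hB lt.
have yA : y \notin A.
  by apply: contra yAx => yA; rewrite !inE yA (contraNneq _ xB) // => <-.
by exists y; rewrite !inE ?yA ?yB // Py (card_exch xA yA) cA eqxx.
Qed.

Definition truncation (T : finType) (M : matroid T) : matroid T :=
  Matroid (truncation_axiom M).

Lemma truncation_rk0 (T : finType) (M : matroid T) : rk M = 0 -> truncation M = M.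
Proof.
move=> r0; apply: val_inj; apply/setP => I; rewrite /= !inE r0 /=.
have b0 B : B \in bases M -> B = set0.
  by move=> /card_basis; rewrite r0 => /eqP; rewrite cards_eq0 => /eqP.
have [B hB] := bases_ex M; have e0 := b0 B hB.
apply/idP/idP => [/andP[_]|hI].
  by rewrite cards_eq0 => /eqP->; rewrite -e0.
by rewrite (b0 I hI) cards0 eqxx andbT; have [] := indep_axiomsP M.
Qed.

Definition copy_bases (T S : finType) (f : T -> S) (M : matroid T) : {set {set S}} :=
  [set f @: (B : {set T}) | B in bases M].

Lemma copy_axiom (T S : finType) (f : T -> S) (hf : bijective f) (M : matroid T) :
  (copy_bases f M != set0) && exchange (copy_bases f M).
Proof.
have inj := bij_inj hf; apply/andP; split.
  by have [B hB] := bases_ex M; apply/set0Pn; exists (f @: B); apply: imset_f.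
apply/exchangeP => _ _ /imsetP[A hA ->] /imsetP[B hB ->] _ /setDP[/imsetP[x xA ->]].
rewrite mem_imset // => xB.
have [|y /setDP[yB yA] hy] := basesX (x := x) hA hB; first by rewrite inE xB xA.
exists (f y); first by rewrite inE !mem_imset // yA yB.
apply/imsetP; exists (y |: (A :\ x)) => //.
have [g _ gK] := hf; apply/setP => z; rewrite -(gK z).
by rewrite mem_imset // !inE mem_imset // !(inj_eq inj).
Qed.

(* The copy of M along a bijection of ground sets. *)
Definition copy (T S : finType) (f : T -> S) (hf : bijective f) (M : matroid T) :
  matroid S := Matroid (copy_axiom hf M).

Definition wedge_bases (T : finType) (M N : matroid T) : {set {set T}} :=
  [set X | minset [in [set B :&: B' | B in bases M, B' in bases N]] X].

(* The complements of the sets in wedge_bases M N are the bases of the union of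
   the duals of M and N. *)
Lemma wedge_axiom (T : finType) (M N : matroid T) :
  (wedge_bases M N != set0) && exchange (wedge_bases M N).
Proof.
have ax := indep_union_axioms (indep_axiomsP (dual M)) (indep_axiomsP (dual N)).
pose U := Matroid (indep_axioms_matroid ax).
suff -> : wedge_bases M N = bases (dual U) by apply: matroid_axiom.
set F := [set B :&: B' | B in bases M, B' in bases N].
have sub X : indep_union (indep (dual M)) (indep (dual N)) X <->
             exists2 Y, Y \in F & X \subset ~: Y.
  split=> [/existsP[A /existsP[B /and3P[]]] | [_ /imset2P[A B hA hB ->] sX]].
    case/indepP => _ /imsetP[A' hA ->] sA /indepP[_ /imsetP[B' hB ->] sB] /eqP->.
    exists (A' :&: B'); first exact: imset2_f.
    by rewrite setCI setUSS.
  apply/existsP; exists (X :\: A); apply/existsP; exists (X :\: B).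
  apply/and3P; split.
  - by apply/indepP; exists (~: A); [apply: imset_f | rewrite setDE subsetIr].
  - by apply/indepP; exists (~: B); [apply: imset_f | rewrite setDE subsetIr].
  by rewrite -setDIr setDE (setIidPl sX).
apply/setP => X; rewrite inE; apply/minsetP/imsetP => [[XF minX] | [Y]].
  exists (~: X); rewrite ?setCK // inE; apply/maxsetP; split.
    by apply/sub; exists X.
  move=> Z /sub[Y YF sZY] sXZ.
  have sYX : Y \subset X by rewrite -setCS (subset_trans sXZ).
  have eYX := minX _ YF sYX; rewrite eYX in sZY.
  by apply/eqP; rewrite eqEsubset sZY.
rewrite inE => /maxsetP[/sub[Z ZF sYZ] maxY] ->.
have eZ : ~: Z = Y by apply: maxY => //; apply/sub; exists Z.
have eZY : ~: Y = Z by rewrite -eZ setCK.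
split=> [|W WF sWY]; first by rewrite eZY.
have eW : ~: W = Y.
  by apply: maxY; [apply/sub; exists W | rewrite -[Y]setCK setCS].
by rewrite -eW setCK.
Qed.

Definition wedge (T : finType) (M N : matroid T) : matroid T :=
  Matroid (wedge_axiom M N).

Lemma boolean_axiom (T : finType) :
  ([set [set: T]] != set0) && exchange [set [set: T]].
Proof.
apply/andP; split; first by apply/set0Pn; exists setT; rewrite inE.
by apply/exchangeP => A B; rewrite !inE => /eqP-> /eqP-> x; rewrite setDv inE.
Qed.

Definition boolean (T : finType) : matroid T := Matroid (boolean_axiom T).

Definition dsum_bases (E1 E2 : finType) (M : matroid E1) (N : matroid E2) :
    {set {set (E1 + E2)%type}} :=
  [set (inl @: (B : {set E1})) :|: (inr @: (B' : {set E2}))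
     | B in bases M, B' in bases N].

Lemma in_dsuml (E1 E2 : finType) (A : {set E1}) (B : {set E2}) x :
  (inl x \in ((inl @: A) :|: (inr @: B) : {set (E1 + E2)%type})) = (x \in A).
Proof.
rewrite inE mem_imset; last by move=> ? ? [].
by case: (x \in A) => //=; apply/negbTE/negP => /imsetP[].
Qed.

Lemma in_dsumr (E1 E2 : finType) (A : {set E1}) (B : {set E2}) x :
  (inr x \in ((inl @: A) :|: (inr @: B) : {set (E1 + E2)%type})) = (x \in B).
Proof.
rewrite inE orbC mem_imset; last by move=> ? ? [].
by case: (x \in B) => //=; apply/negbTE/negP => /imsetP[].
Qed.

Lemma dsum_axiom (E1 E2 : finType) (M : matroid E1) (N : matroid E2) :
  (dsum_bases M N != set0) && exchange (dsum_bases M N).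
Proof.
apply/andP; split.
  have [A hA] := bases_ex M; have [B hB] := bases_ex N.
  by apply/set0Pn; exists (inl @: A :|: inr @: B); apply: imset2_f.
apply/exchangeP => _ _ /imset2P[A A' hA hA' ->] /imset2P[B B' hB hB' ->].
case=> x; rewrite inE ?in_dsuml ?in_dsumr => xAB.
  have [|y] := basesX (x := x) hA hB; first by rewrite inE.
  rewrite inE => yBA hy; exists (inl y); first by rewrite inE !in_dsuml.
  apply/imset2P; exists (y |: (A :\ x)) A' => //.
  by apply/setP => [[z|z]]; rewrite !(in_dsuml, in_dsumr, in_setU1, in_setD1).
have [|y] := basesX (x := x) hA' hB'; first by rewrite inE.
rewrite inE => yBA hy; exists (inr y); first by rewrite inE !in_dsumr.
apply/imset2P; exists A (y |: (A' :\ x)) => //.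
by apply/setP => [[z|z]]; rewrite !(in_dsuml, in_dsumr, in_setU1, in_setD1).
Qed.

Definition dsum (E1 E2 : finType) (M : matroid E1) (N : matroid E2) :
  matroid (E1 + E2)%type := Matroid (dsum_axiom M N).

(* The deletion M \ E1: its independent sets are the subsets of E2 that are
   independent in M. *)
Definition deletel_bases (E1 E2 : finType) (M : matroid (E1 + E2)%type) :
    {set {set E2}} :=
  [set J | maxset (fun I : {set E2} => indep M (inr @: I)) J].

Lemma deletel_axiom (E1 E2 : finType) (M : matroid (E1 + E2)%type) :
  (deletel_bases M != set0) && exchange (deletel_bases M).
Proof.
have [P0 Psub Paug] := indep_axiomsP M.
have inj : injective (@inr E1 E2) by move=> ? ? [].
apply: (@indep_axioms_matroid _ (fun I : {set E2} => indep M (inr @: I))).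
split=> [|I J sIJ | I J hI hJ ltIJ]; first by rewrite imset0.
  by apply: Psub; apply: imsetS.
have [|_ /setDP[/imsetP[x xJ ->]]] := Paug _ _ hI hJ; first by rewrite !card_imset.
rewrite mem_imset // => xI Px; exists x; first by rewrite inE xI.
by rewrite imsetU1.
Qed.

Definition deletel (E1 E2 : finType) (M : matroid (E1 + E2)%type) : matroid E2 :=
  Matroid (deletel_axiom M).

Definition correspondence (E1 E2 : finType) (C : matroid (E1 + E2)%type)
    (M : matroid E1) : matroid E2 :=
  deletel (wedge (dsum M (boolean E2)) C).

(* Main.v *)
Require Import Defs.
From mathcomp Require Import all_boot.
From mathcomp Require Import zify.

Set Implicit Arguments.
Unset Strict Implicit.
Unset Printing Implicit Defensive.

(** Let n = #|E| and let D be the matroid on the disjoint union of E and its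
    copy whose bases are the transversals of the pairs {e, e*}.  The
    correspondence of D sends M to its copy, and the matroid that works here is
    C = T(D).  Its bases are the sets A + S* with A and S disjoint in E and
    #|A| + #|S| = n - 1, that is (for n > 0) the complement of A is S together
    with one extra point x.

    Let M have rank r.  The sets competing in the intersection of
    M (+) Boolean with C are the sets (B :&: A) + S* with B a basis of M, and
    since B is covered by B :&: A, S and x, they have at least r - 1 elements.
    When r > 0, equality forces S and x to lie in B: so S is independent in M
    and has at most r - 1 elements.  Conversely any
    such S can be enlarged by a point x of a basis containing it and then
    attains the bound.  Because minimal sets of the intersection all have the
    same size, the bases of the intersection are the competitors of size
    r - 1, and the subsets of E* they contain are the copies of the
    independent sets of T(M).  When r = 0 the basis B is empty, the
    least size is 0, and it is attained by S empty and any A allowed by C;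
    only the empty set survives, as it should since then T(M) = M. *)

(** * Independent sets determine a matroid *)

Section Independence.
Variable T : finType.
Implicit Types (M N : matroid T) (I J A B : {set T}).

Lemma basis_maxindep M B : (B \in bases M) = maxset (indep M) B.
Proof.
have h A : A \in bases M -> maxset (indep M) A.
  move=> hA; apply/maxsetP; split=> [|J /indepP[A' hA' sJ] sAJ].
    by apply/indepP; exists A.
  apply/eqP; rewrite eq_sym eqEcard sAJ (card_bases hA hA').
  exact: subset_leq_card.
apply/idP/idP => [/h //|/maxsetP[/indepP[A hA sBA] maxB]].
by rewrite -(maxB A) //; apply: maxsetp (h _ hA).
Qed.

Lemma eq_indep M N : indep M =1 indep N -> M = N.
Proof.
move=> e; apply: val_inj; apply/setP => B /=.
by rewrite !basis_maxindep; apply: maxset_eq.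
Qed.

Lemma subset_between_card A B k : A \subset B -> #|A| <= k <= #|B| ->
  exists2 X : {set T}, A \subset X & (X \subset B) && (#|X| == k).
Proof.
move=> sAB; elim: k => [|k IHk] /andP[leA leB].
  by exists A; rewrite // sAB -leqn0.
have [eA | neA] := eqVneq #|A| k.+1; first by exists A; rewrite // sAB eA eqxx.
have [|X sAX /andP[sXB /eqP cX]] := IHk; first by lia.
have /properP[_ [x xB xX]] : X \proper B by rewrite properEcard sXB cX.
exists (x |: X); first exact: subset_trans sAX (subsetUr _ _).
by rewrite subUset sub1set xB sXB cardsU1 xX cX add1n eqxx.
Qed.

Lemma indep_truncation M I :
  indep (truncation M) I = indep M I && (#|I| <= (rk M).-1).
Proof.
have [_ Psub _] := indep_axiomsP M.
apply/indepP/andP => [[J] | [/indepP[B hB sIB] cI]].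
  rewrite inE => /andP[hJ /eqP <-] sIJ.
  by split; [apply: Psub hJ | apply: subset_leq_card].
have [|X sIX /andP[sXB cX]] := @subset_between_card I B (rk M).-1 sIB.
  by rewrite cI (card_basis hB) leq_pred.
by exists X; rewrite // inE cX andbT; apply/indepP; exists B.
Qed.

(** The inclusion-minimal intersections all have the same size, being the bases of a
    matroid, so minimality can be tested by counting: this turns the
    intersection into a pure extremal problem. *)
Lemma mem_wedge_card M N (k : nat) X :
    (forall B B', B \in bases M -> B' \in bases N -> k <= #|B :&: B'|) ->
    (exists B B', [/\ B \in bases M, B' \in bases N & #|B :&: B'| = k]) ->
  X \in bases (wedge M N) <->
    exists B B', [/\ B \in bases M, B' \in bases N, X = B :&: B' & #|X| = k].
Proof.
move=> lek [B0 [B0' [hB0 hB0' c0]]].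
have min B B' : B \in bases M -> B' \in bases N -> #|B :&: B'| = k ->
    B :&: B' \in bases (wedge M N).
  move=> hB hB' c; rewrite inE; apply/minsetP; split.
    exact: imset2_f.
  move=> Y /imset2P[A A' hA hA' ->] s.
  by apply/eqP; rewrite eqEcard s c lek.
split=> [hX | [B [B' [hB hB' -> c]]]]; last exact: min.
have cX := card_bases hX (min _ _ hB0 hB0' c0).
move: hX; rewrite inE => /minsetp/imset2P[B B' hB hB' eX].
by exists B, B'; split; rewrite // cX.
Qed.

End Independence.

Lemma indep_copy (T S : finType) (f : T -> S) (hf : bijective f)
    (M : matroid T) (I : {set T}) : indep (copy hf M) (f @: I) = indep M I.
Proof.
have inj := bij_inj hf.
apply/indepP/indepP => [[_ /imsetP[B hB ->] s] | [B hB s]].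
  by exists B => //; apply/subsetP => x xI; rewrite -(mem_imset _ _ inj)
    (subsetP s) // imset_f.
by exists (f @: B); [apply: imset_f | apply: imsetS].
Qed.

Lemma indep_deletel (E1 E2 : finType) (M : matroid (E1 + E2)%type)
    (J : {set E2}) : indep (deletel M) J = indep M (inr @: J).
Proof.
have [_ Psub _] := indep_axiomsP M.
apply/indepP/idP => [[B] | hJ].
  by rewrite inE => /maxsetp hB sJB; apply: Psub hB; apply: imsetS.
have [B hB sJB] := @maxset_exists _ (fun I : {set E2} => indep M (inr @: I)) _ hJ.
by exists B; rewrite ?inE.
Qed.

(** * Subsets of a disjoint union *)

Section SumSet.
Variables E1 E2 : finType.
Implicit Types (A B : {set E1}) (S T : {set E2}).

Definition sumset A S : {set (E1 + E2)%type} := (inl @: A) :|: (inr @: S).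

Lemma sumsetK (X : {set (E1 + E2)%type}) :
  X = sumset (inl @^-1: X) (inr @^-1: X).
Proof. by apply/setP => [[x|x]]; rewrite ?in_dsuml ?in_dsumr inE. Qed.

Lemma sumset_inr S : inr @: S = sumset set0 S.
Proof. by rewrite /sumset imset0 set0U. Qed.

Lemma card_sumset A S : #|sumset A S| = #|A| + #|S|.
Proof.
rewrite cardsU disjoint_setI0 ?cards0 ?subn0.
  by rewrite !card_imset // => ? ? [].
by apply/pred0P => -[x|x]; apply/negbTE/negP => /andP[/imsetP[y _ e]/imsetP[z _ e']].
Qed.

Lemma sumsetS A S B T :
  (sumset A S \subset sumset B T) = (A \subset B) && (S \subset T).
Proof.
apply/idP/andP => [s | [sA sS]]; last by rewrite setUSS ?imsetS.
split; apply/subsetP => x xA.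
  by rewrite -(in_dsuml B T) (subsetP s) // in_dsuml.
by rewrite -(in_dsumr B T) (subsetP s) // in_dsumr.
Qed.

Lemma sumsetI A S B T :
  sumset A S :&: sumset B T = sumset (A :&: B) (S :&: T).
Proof. by apply/setP => [[x|x]]; rewrite inE ?in_dsuml ?in_dsumr inE. Qed.

Lemma dsum_booleanP (M : matroid E1) X :
  reflect (exists2 B, B \in bases M & X = sumset B setT)
          (X \in bases (dsum M (boolean E2))).
Proof.
apply: (iffP imset2P) => [[B B' hB] | [B hB ->]].
  by rewrite inE => /eqP-> ->; exists B.
by exists B setT; rewrite ?inE.
Qed.

End SumSet.

(** * The matroid inducing truncation *)

Section Diagonal.
Variables (E Estar : finType) (star : E -> Estar).
Hypothesis hstar : bijective star.
Implicit Types (A B I S : {set E}).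

Let star_inj : injective star := bij_inj hstar.

Lemma star_imset (J : {set Estar}) : exists S, J = star @: S.
Proof.
exists (star @^-1: J); have [g _ gK] := hstar.
by apply/setP => y; rewrite -(gK y) mem_imset // inE.
Qed.

Lemma subset_star S S' : (star @: S \subset star @: S') = (S \subset S').
Proof.
apply/idP/idP => [/subsetP s|]; last exact: imsetS.
by apply/subsetP => x xS; rewrite -(mem_imset _ _ star_inj) s // imset_f.
Qed.

Definition diagonal_bases : {set {set (E + Estar)%type}} :=
  [set sumset (~: S) (star @: S) | S : {set E}].

(** To exchange an element of a transversal of the pairs {e, e*}, swap it
    with the other element of its pair. *)
Lemma diagonal_axiom : (diagonal_bases != set0) && exchange diagonal_bases.
Proof.
apply/andP; split.
  by apply/set0Pn; exists (sumset (~: set0) (star @: set0)); apply: imset_f.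
have [g _ gK] := hstar.
apply/exchangeP => _ _ /imsetP[A _ ->] /imsetP[B _ ->] [x|y'].
  rewrite in_setD !in_dsuml !inE negbK => /andP[xB xA].
  exists (inr (star x)).
    by rewrite in_setD !in_dsumr !mem_imset // xB xA.
  apply/imsetP; exists (x |: A) => //; apply/setP => [[z|z]].
    by rewrite in_setU1 in_setD1 !in_dsuml !inE negb_or.
  by rewrite -(gK z) in_setU1 in_setD1 !in_dsumr !mem_imset // !inE
    /= !(inj_eq star_inj, inj_eq inr_inj).
rewrite -(gK y'); set x := g y'.
rewrite in_setD !in_dsumr !mem_imset // => /andP[xB xA].
exists (inl x); first by rewrite in_setD !in_dsuml !inE xB xA.
apply/imsetP; exists (A :\ x) => //; apply/setP => [[z|z]].
  by rewrite in_setU1 in_setD1 !in_dsuml !inE negb_and negbK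
    /= (inj_eq inl_inj).
by rewrite -(gK z) in_setU1 in_setD1 !in_dsumr !mem_imset // !inE
  /= !(inj_eq inr_inj, inj_eq star_inj).
Qed.

Definition diagonal : matroid (E + Estar)%type := Matroid diagonal_axiom.

Lemma indep_diagonal A S :
  indep diagonal (sumset A (star @: S)) = [disjoint A & S].
Proof.
rewrite disjoints_subset.
apply/indepP/idP => [[_ /imsetP[S' _ ->]] | dAS].
  rewrite sumsetS subset_star => /andP[sA sS].
  by apply: subset_trans sA _; rewrite setCS.
exists (sumset (~: S) (star @: S)); first exact: imset_f.
by rewrite sumsetS dAS subxx.
Qed.

Lemma rk_diagonal : rk diagonal = #|E|.
Proof.
have h : sumset (~: set0) (star @: set0) \in bases diagonal by apply: imset_f.
by rewrite -(card_basis h) card_sumset imset0 cards0 addn0 setC0 cardsT.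
Qed.

Lemma basis_truncation_diagonal A S :
  (sumset A (star @: S) \in bases (truncation diagonal)) =
    [disjoint A & S] && (#|A| + #|S| == #|E|.-1).
Proof.
by rewrite inE indep_diagonal rk_diagonal card_sumset card_imset.
Qed.

(** At most one point of E lies outside both A and S, so B loses at most
    #|S| + 1 points when cut down to A. *)
Lemma leq_card_competitor (M : matroid E) A B S :
    B \in bases M -> [disjoint A & S] -> #|A| + #|S| = #|E|.-1 ->
  (rk M).-1 <= #|B :&: A| + #|S|.
Proof.
move=> hB _ c; have := cardsC A; have := cardsID A B.
have : #|B :\: A| <= #|~: A| by apply: subset_leq_card; rewrite setDE subsetIr.
rewrite (card_basis hB); lia.
Qed.

(** The bound of [leq_card_competitor] is attained above every set that is
    independent in the truncation: for S = I, let A omit one more point, taken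
    in B when I is not all of B. *)
Lemma card_competitor_attained (M : matroid E) B I :
    B \in bases M -> I \subset B -> #|I| <= (rk M).-1 ->
  exists A, [/\ [disjoint A & I], #|A| + #|I| = #|E|.-1
              & #|B :&: A| + #|I| = (rk M).-1].
Proof.
move=> hB sIB cI; have cB := card_basis hB.
have omit x : x \notin I -> (x \in B) || (rk M == 0) ->
  exists A, [/\ [disjoint A & I], #|A| + #|I| = #|E|.-1
              & #|B :&: A| + #|I| = (rk M).-1].
  move=> xI xB; exists (~: (x |: I)); split.
  - by rewrite disjoints_subset setCS subsetUr.
  - by have := cardsC (x |: I); rewrite cardsU1 xI; lia.
  have [r0 | r0] := eqVneq (rk M) 0.
    have : #|B :&: ~: (x |: I)| <= #|B| by rewrite subset_leq_card ?subsetIl.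
    by lia.
  have {}xB : x \in B by move: xB; rewrite (negbTE r0) orbF.
  have := cardsID (x |: I) B; rewrite setDE (setIidPr _) ?subUset ?sub1set ?xB //.
  rewrite cardsU1 xI; lia.
have [D0 | [x /setDP[xB xI]]] := set_0Vmem (B :\: I); last first.
  by apply: (omit x); rewrite ?xB.
have eIB : I = B by apply/eqP; rewrite eqEsubset sIB -setD_eq0 D0 eqxx.
have r0 : rk M = 0 by move: cI; rewrite eIB; lia.
have I0 : I = set0 by apply: cards0_eq; lia.
have [x _ | E0] := pickP (@predT E).
  by apply: (omit x); rewrite ?I0 ?inE // r0 eqxx orbT.
have cE : #|E| = 0 by apply: eq_card0.
exists set0; split; rewrite ?I0 ?setI0 ?cards0 ?cE ?r0 //.
by rewrite disjoints_subset sub0set.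
Qed.

(** Both inclusions are the equality case of the bound: a basis of the
    intersection attains it, which puts S inside B, and conversely each
    admissible I sits in a set attaining it. *)
Lemma indep_wedge_diagonal (M : matroid E) I :
  indep (wedge (dsum M (boolean Estar)) (truncation diagonal))
        (inr @: (star @: I)) = indep M I && (#|I| <= (rk M).-1).
Proof.
set N := dsum _ _; set C := truncation _.
have CP Y : Y \in bases C -> exists A S,
    [/\ Y = sumset A (star @: S), [disjoint A & S] & #|A| + #|S| = #|E|.-1].
  rewrite [Y]sumsetK; have [S ->] := star_imset (inr @^-1: Y).
  rewrite basis_truncation_diagonal => /andP[d /eqP c].
  by exists (inl @^-1: Y), S.
have lek X Y : X \in bases N -> Y \in bases C -> (rk M).-1 <= #|X :&: Y|.
  move=> /dsum_booleanP[B hB ->] /CP[A [S [-> d c]]].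
  rewrite sumsetI setTI card_sumset card_imset //.
  exact: leq_card_competitor.
have attained B (J : {set E}) : B \in bases M -> J \subset B -> #|J| <= (rk M).-1 ->
    exists X Y, [/\ X \in bases N, Y \in bases C, #|X :&: Y| = (rk M).-1
                  & star @: J = inr @^-1: (X :&: Y)].
  move=> hB sJB cJ; have [A [d c cBA]] := card_competitor_attained hB sJB cJ.
  exists (sumset B setT), (sumset A (star @: J)); split.
  - by apply/dsum_booleanP; exists B.
  - by rewrite basis_truncation_diagonal d c eqxx.
  - by rewrite sumsetI setTI card_sumset card_imset.
  by apply/setP => z; rewrite sumsetI setTI inE in_dsumr.
have ex : exists X Y, [/\ X \in bases N, Y \in bases C & #|X :&: Y| = (rk M).-1].
  have [B hB] := bases_ex M.
  have c0 : #|set0 : {set E}| <= (rk M).-1 by rewrite cards0.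
  have [X [Y [hX hY c _]]] := attained B set0 hB (sub0set _) c0.
  by exists X, Y.
apply/indepP/andP => [[Z /(mem_wedge_card _ lek ex)] | [/indepP[B hB sIB] cI]].
  move=> [_ [_ [/dsum_booleanP[B hB ->] /CP[A [S [-> d c]]] ->]]] {Z}.
  rewrite sumsetI setTI card_sumset card_imset // => cX.
  rewrite sumset_inr sumsetS sub0set subset_star /= => sIS.
  have leI := subset_leq_card sIS; split; last by lia.
  have [r0 | r0] := eqVneq (rk M) 0.
    have -> : I = set0 by apply: cards0_eq; lia.
    by have [] := indep_axiomsP M.
  apply/indepP; exists B => //; apply: subset_trans sIS _.
  (* Equality in the bound forces B :\: A to be the whole complement of A. *)
  have sBA : B :\: A \subset ~: A by rewrite setDE subsetIr.
  have eBA : B :\: A = ~: A.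
    apply/eqP; rewrite eqEcard sBA.
    have := cardsC A; have := cardsID A B; rewrite (card_basis hB).
    by lia.
  have sSA : S \subset ~: A by rewrite -disjoints_subset disjoint_sym.
  by apply: subset_trans sSA _; rewrite -eBA subsetDl.
have [X [Y [hX hY c eI]]] := attained B I hB sIB cI.
exists (X :&: Y); first by apply/(mem_wedge_card _ lek ex); exists X, Y.
by rewrite sumset_inr [X :&: Y]sumsetK sumsetS sub0set eI subxx.
Qed.

End Diagonal.

Theorem corollary3p2 (E Estar : finType) (star : E -> Estar)
    (hstar : bijective star) :
  exists C : matroid (E + Estar)%type,
    forall M : matroid E, correspondence C M = copy hstar (truncation M).
Proof.
exists (truncation (diagonal hstar)) => M; apply: eq_indep => J.
have [I ->] := star_imset hstar J.
by rewrite indep_deletel indep_wedge_diagonal indep_copy indep_truncation.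
Qed.
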